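(* Let $d\ge2$. Then $$m_{\mathcal{P}}(d)\le\overline{m}_{\mathcal{P}}(d)\le m_{\mathcal{P}}(d)+1.$$
   Context: A polyhedron is an intersection of finitely many closed halfspaces; a polytope is a bounded polyhedron. For a $d$-dimensional polyhedron $P\subset\mathbb{R}^d$, $m_{\mathcal{P}}(P)$ denotes the minimal number $l$ of polynomials $\mathfrak{p}_1,\dots,\mathfrak{p}_l\in\mathbb{R}[x_1,\dots,x_d]$ such that $P=\{x\in\mathbb{R}^d : \mathfrak{p}_1(x)\ge0,\dots,\mathfrak{p}_l(x)\ge0\}$; $m_{\mathcal{P}}(\mathbb{R}^d)=0$. Moreover $$\overline{m}_{\mathcal{P}}(d)=\max\{m_{\mathcal{P}}(P): P\subset\mathbb{R}^d\text{ a }d\text{-dimensional polyhedron}\},$$ $$m_{\mathcal{P}}(d)=\max\{m_{\mathcal{P}}(P): P\subset\mathbb{R}^d\text{ a }d\text{-dimensional polytope}\}.$$ These maxima are finite: by a theorem of Bröcker and Scheiderer both are at most $d(d+1)/2$. *)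

(* Defs.v *)
From mathcomp Require Import all_boot all_order all_algebra.
From mathcomp Require Import all_classical all_reals all_analysis.
From mathcomp Require Import -(notations) mpoly.

Set Implicit Arguments.
Unset Strict Implicit.
Unset Printing Implicit Defensive.

Import Order.TTheory GRing.Theory Num.Theory.
Import numFieldNormedType.Exports.
Local Open Scope classical_set_scope.
Local Open Scope ring_scope.

(* The value is 0 when the minimum (resp. maximum) does not exist; see
   nat_min_spec and nat_max_spec below. *)
Definition nat_min (A : set nat) : nat := xget 0%N (A `&` lbound A).
Definition nat_max (A : set nat) : nat := xget 0%N (A `&` ubound A).

Definition closed_halfspace (R : realType) (d : nat) (H : set 'rV[R]_d) : Prop :=
  exists (a : 'rV[R]_d) (b : R),
    a != 0 /\ H = [set x | \sum_(i < d) a 0 i * x 0 i <= b].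

(* The case n = 0 is the whole space. *)
Definition polyhedron (R : realType) (d : nat) (P : set 'rV[R]_d) : Prop :=
  exists (n : nat) (H : 'I_n -> set 'rV[R]_d),
    (forall i, closed_halfspace (H i)) /\ P = \bigcap_(i in [set: 'I_n]) H i.

Definition polytope (R : realType) (d : nat) (P : set 'rV[R]_d) : Prop :=
  polyhedron P /\ bounded_set P.

Definition affine_hull (R : realType) (d : nat) (A : set 'rV[R]_d) :
    set 'rV[R]_d :=
  [set x | exists (n : nat) (c : 'I_n -> R) (y : 'I_n -> 'rV[R]_d),
    [/\ forall i, A (y i), \sum_(i < n) c i = 1
      & x = \sum_(i < n) c i *: y i]].

(* The affine hull of A is a translate of a k-dimensional linear subspace; the
   empty set has no dimension. *)
Definition has_dim (R : realType) (d : nat) (A : set 'rV[R]_d) (k : nat) : Prop :=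
  exists (x0 : 'rV[R]_d) (V : {vspace 'rV[R]_d}),
    \dim V = k /\ affine_hull A = [set x | x - x0 \in V].

Definition peval (R : realType) (d : nat) (p : mpoly d R) (x : 'rV[R]_d) : R :=
  meval (fun i => x 0 i) p.

Definition describes (R : realType) (d l : nat) (p : 'I_l -> mpoly d R)
    (P : set 'rV[R]_d) : Prop :=
  P = [set x | forall i, 0 <= peval (p i) x].

Definition mP (R : realType) (d : nat) (P : set 'rV[R]_d) : nat :=
  nat_min [set l | exists p : 'I_l -> mpoly d R, describes p P].

(* By the theorem of Broecker and Scheiderer the two sets below are bounded by
   d * (d + 1) / 2, so both maxima exist and the default value of nat_max plays
   no role. *)
Definition mP_polyhedra (R : realType) (d : nat) : nat :=
  nat_max [set mP P | P in [set P : set 'rV[R]_d | polyhedron P /\ has_dim P d]].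

Definition mP_polytopes (R : realType) (d : nat) : nat :=
  nat_max [set mP P | P in [set P : set 'rV[R]_d | polytope P /\ has_dim P d]].

Lemma nat_min_spec (A : set nat) : A !=set0 ->
  A (nat_min A) /\ forall k, A k -> (nat_min A <= k)%N.
Proof.
move=> [k Ak]; apply: (@xgetPex _ 0%N (A `&` lbound A)).
have exA : exists n, `[< A n >] by exists k; apply/asboolP.
exists (ex_minn exA); case: ex_minnP => m /asboolP Am mmin.
by split=> // j Aj; rewrite leEnat mmin//; apply/asboolP.
Qed.

Lemma nat_max_spec (A : set nat) (b : nat) : A !=set0 ->
  (forall k, A k -> (k <= b)%N) ->
  A (nat_max A) /\ forall k, A k -> (k <= nat_max A)%N.
Proof.
move=> [k Ak] Ab; apply: (@xgetPex _ 0%N (A `&` ubound A)).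
have exA : exists n, `[< A n >] by exists k; apply/asboolP.
have bA n : `[< A n >] -> (n <= b)%N by move=> /asboolP; apply: Ab.
exists (ex_maxn exA bA); case: ex_maxnP => m /asboolP Am mmax.
by split=> // j Aj; rewrite leEnat mmax//; apply/asboolP.
Qed.

Lemma polyhedron_describable (R : realType) (d : nat) (P : set 'rV[R]_d) :
  polyhedron P -> exists l (p : 'I_l -> mpoly d R), describes p P.
Proof.
move=> [n [H [Hhalf ->]]]; exists n.
have /choice[p pP] i : exists p : mpoly d R,
    H i = [set x | 0 <= peval p x].
  have [a [b [_ ->]]] := Hhalf i.
  exists (mpolyC d b -
    \sum_(j < d) a 0 j *: mpolyX R (mnm1 j)).
  have pE x : peval (mpolyC d b - \sum_(j < d) a 0 j *: mpolyX R (mnm1 j)) x =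
      b - \sum_(j < d) a 0 j * x 0 j.
    rewrite /peval mevalB mevalC (raddf_sum (meval _)); congr (_ - _).
    by apply: eq_bigr => j _; rewrite [LHS]mevalZ mevalXU.
  by apply/seteqP; split=> x /=; rewrite pE subr_ge0.
exists p; apply/seteqP; split=> x.
  by move=> Hx i; have := Hx i Logic.I; rewrite pP.
by move=> Hx i _; rewrite pP; exact: Hx.
Qed.

Lemma mP_spec (R : realType) (d : nat) (P : set 'rV[R]_d) : polyhedron P ->
  (exists p : 'I_(mP P) -> mpoly d R, describes p P) /\
  forall (l : nat) (p : 'I_l -> mpoly d R), describes p P -> (mP P <= l)%N.
Proof.
move=> /polyhedron_describable[l [p pP]].
have [|? mmin] := @nat_min_spec
  [set l | exists p : 'I_l -> mpoly d R, describes p P].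
  by exists l, p.
by split=> // k q qP; apply: mmin; exists q.
Qed.

Lemma mP_setT (R : realType) (d : nat) : mP [set: 'rV[R]_d] = 0%N.
Proof.
have polT : polyhedron [set: 'rV[R]_d].
  by exists 0%N, (fun=> setT); split=> [[]//|]; apply/seteqP; split.
have [_ /(_ 0%N (fun=> 0)) h] := mP_spec polT.
apply/eqP; rewrite -leqn0; apply: h.
by apply/seteqP; split=> // x _ [].
Qed.

(* Main.v *)
Require Import Defs.
From mathcomp Require Import all_boot all_order all_algebra all_classical all_reals.
From mathcomp Require Import all_analysis.
From mathcomp Require Import -(notations) mpoly.
From mathcomp Require Import lra.

Set Implicit Arguments.
Unset Strict Implicit.
Unset Printing Implicit Defensive.

Import Order.TTheory GRing.Theory Num.Theory.
Import numFieldNormedType.Exports.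
Local Open Scope classical_set_scope.
Local Open Scope ring_scope.

(** The first inequality holds because every polytope is a polyhedron.  For the
second one, every full-dimensional polyhedron [P] is compared with a
full-dimensional polytope [Q] such that [mP P <= mP Q + 1]
([mP_le_polytope]).

Translate an interior point of [P] to the origin and rescale the normals, so
that [P] is given by [a_i.x <= 1] for [i < n].  With [t = 1 / (n + 1)], the
affine function [s x = 1 - t * \sum_i a_i.x] is at least [t] on [P].  The
projective map [x |-> x / s x] therefore is defined on [P]; since
[1 / s x = 1 + t * \sum_i a_i.y] for [y = x / s x], the inequality
[a_i.x <= 1] becomes the affine inequality [a_i.y <= 1 + t * \sum_k a_k.y].
The values [a_i.y] turn out to be bounded on the image, so the image is bounded
up to the lineality space of [P].  To deal with lineality, [x] is first
multiplied by a matrix [M] that leaves every [a_i.x] unchanged and whose values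
are determined by the [a_i.x]: then [y = x M / s x] stays in a fixed cube, and
[Q] is cut out of this cube by the inequalities above.  In this way
[x] lies in [P] if and only if [t <= s x] and [x M / s x] lies in [Q]
([projective_polytope]).

If [Q] is described by [l] polynomials [q_i], then multiplying [q_i (x M / s x)]
by a high power of [s x], which is positive where [t <= s x], gives a
polynomial; these [l] polynomials together with [s - t] describe [P]
([describes_projective_preimage]).  Requiring [t <= s x] instead of [0 <= s x]
matters: the cleared polynomials all vanish on the hyperplane [s x = 0], which
lies outside [P].

The comparison of single polyhedra passes to the maxima: the two sets of values
are simultaneously bounded or unbounded, and in the latter case both maxima
take their default value ([nat_max_dominated]). *)

(** * Linear forms *)

Definition dot (R : realType) (d : nat) (a x : 'rV[R]_d) : R :=
  \sum_(i < d) a 0 i * x 0 i.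

Lemma dotDl (R : realType) (d : nat) (a b x : 'rV[R]_d) :
  dot (a + b) x = dot a x + dot b x.
Proof. by rewrite /dot -big_split; apply: eq_bigr => i _; rewrite mxE mulrDl. Qed.

Lemma dotBr (R : realType) (d : nat) (a x y : 'rV[R]_d) :
  dot a (x - y) = dot a x - dot a y.
Proof. by rewrite /dot -sumrB; apply: eq_bigr => i _; rewrite !mxE mulrBr. Qed.

Lemma dotZl (R : realType) (d : nat) (k : R) (a x : 'rV[R]_d) :
  dot (k *: a) x = k * dot a x.
Proof. by rewrite /dot mulr_sumr; apply: eq_bigr => i _; rewrite mxE mulrA. Qed.

Lemma dotZr (R : realType) (d : nat) (k : R) (a x : 'rV[R]_d) :
  dot a (k *: x) = k * dot a x.
Proof. by rewrite /dot mulr_sumr; apply: eq_bigr => i _; rewrite mxE mulrCA. Qed.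

Lemma dot_suml (R : realType) (d : nat) (I : finType) (f : I -> 'rV[R]_d) x :
  dot (\sum_i f i) x = \sum_i dot (f i) x.
Proof.
rewrite /dot exchange_big; apply: eq_bigr => i _.
by rewrite summxE mulr_suml.
Qed.

Lemma dot_sumr (R : realType) (d : nat) (I : finType) (f : I -> 'rV[R]_d) a :
  dot a (\sum_i f i) = \sum_i dot a (f i).
Proof.
rewrite /dot exchange_big; apply: eq_bigr => i _.
by rewrite summxE mulr_sumr.
Qed.

Lemma dot_eq0 (R : realType) (d : nat) (a : 'rV[R]_d) : dot a a = 0 -> a = 0.
Proof.
move=> /eqP; rewrite psumr_eq0 => [/allP a0|i _]; last by rewrite -expr2 sqr_ge0.
apply/rowP => i; have := a0 i (mem_index_enum i).
by rewrite mulf_eq0 orbb mxE => /eqP.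
Qed.

Lemma dot_delta (R : realType) (d : nat) (j : 'I_d) (x : 'rV[R]_d) :
  dot (delta_mx 0 j) x = x 0 j.
Proof.
rewrite /dot (bigD1 j)//= big1 => [|i ij]; first by rewrite mxE !eqxx mul1r addr0.
by rewrite mxE (negbTE ij) andbF mul0r.
Qed.

(** * Systems of linear inequalities *)

(** A zero normal is allowed: its inequality holds everywhere, by [0 <= b k], so
the halfspaces are indexed by the nonzero normals only. *)
Lemma polyhedron_ineqs (R : realType) (d : nat) (I : finType)
    (a : I -> 'rV[R]_d) (b : I -> R) :
  (forall k, 0 <= b k) -> polyhedron [set x | forall k, dot (a k) x <= b k].
Proof.
move=> b0; pose J := [set k | a k != 0]%SET.
exists #|J|, (fun i => [set x | dot (a (enum_val i)) x <= b (enum_val i)]); split.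
  move=> i; exists (a (enum_val i)), (b (enum_val i)); split=> //.
  by have := enum_valP i; rewrite inE.
apply/seteqP; split=> [x ax i _|x ax k]; first exact: ax.
have [ak0|ak0] := eqVneq (a k) 0.
  by rewrite ak0 /dot big1// => i _; rewrite mxE mul0r.
have kJ : k \in J by rewrite inE.
by have /= := ax (enum_rank_in kJ k) Logic.I; rewrite enum_rankK_in.
Qed.

(** The origin is an interior point, so that every [x] is an affine combination
of [0] and of a short multiple of [x]. *)
Lemma has_dim_ineqs (R : realType) (d : nat) (I : finType)
    (a : I -> 'rV[R]_d) (b : I -> R) :
  (forall k, 0 < b k) -> has_dim [set x | forall k, dot (a k) x <= b k] d.
Proof.
move=> b0; exists 0, fullv; split; first by rewrite dimvf /dim/= mul1n.
apply/seteqP; split=> x _ /=; first exact: memvf.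
(* [t^-1 *: x] satisfies all inequalities: [dot (a k) x <= t * b k]. *)
pose t := 1 + \sum_k `|dot (a k) x| / b k.
have t0 : 0 < t.
  by rewrite ltr_pwDl// sumr_ge0// => k _; rewrite divr_ge0// ltW.
exists 2%N, (fun i => if i == 0 then t else 1 - t),
  (fun i => if i == 0 then t^-1 *: x else 0); split.
- move=> i k; case: ifP => _; last by rewrite /dot big1 ?ltW// => j _; rewrite mxE mulr0.
  rewrite dotZr mulrC ler_pdivrMr// -ler_pdivrMl// mulrC.
  rewrite /t (bigD1 k)//=.
  have := ler_norm (dot (a k) x); rewrite -(ler_pM2r (x:=(b k)^-1)) ?invr_gt0// => h.
  apply: (le_trans h); rewrite addrCA lerDl addr_ge0// sumr_ge0// => j _.
  by rewrite divr_ge0// ltW.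
- by rewrite !big_ord_recl big_ord0/= addr0 addrC subrK.
- by rewrite !big_ord_recl big_ord0/= scaler0 !addr0 scalerA divff ?scale1r// gt_eqF.
Qed.

Lemma bounded_box (R : realType) (d : nat) (K : R) (A : set 'rV[R]_d) :
  0 <= K -> (forall x, A x -> forall j, `|x 0 j| <= K) -> bounded_set A.
Proof.
move=> K0 AK; exists K; split; first exact: num_real.
move=> M KM x Ax; apply: le_trans (ltW KM).
rewrite [leLHS]mx_normrE; apply: bigmax_le => //= -[i j] _ /=.
by rewrite (ord1 i); exact: AK.
Qed.

(** No inequality can be an equality on the whole solution set, for it would then
be one on the affine hull, which is the whole space; the average of points that
make the inequalities strict one at a time makes them all strict. *)
Lemma interior_point (R : realType) (d n : nat) (a : 'I_n -> 'rV[R]_d)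
    (b : 'I_n -> R) : (forall i, a i != 0) ->
  has_dim [set x | forall i, dot (a i) x <= b i] d ->
  exists x0, forall i, dot (a i) x0 < b i.
Proof.
move=> a0 [x1 [V [dV hullV]]]; set P := [set x | _] in hullV.
have hullT x : affine_hull P x.
  rewrite hullV/=; suff -> : V = fullv by exact: memvf.
  by apply/eqP; rewrite eqEdim subvf dV dimvf /dim/= mul1n leqnn.
have /choice[y yP] i : exists y, P y /\ dot (a i) y < b i.
  apply: contrapT => /forallNP noy.
  have eqb x : dot (a i) x = b i.
    have [m [c [y [Py c1 ->]]]] := hullT x.
    rewrite dot_sumr -[RHS]mul1r -c1 mulr_suml; apply: eq_bigr => k _.
    rewrite dotZr; congr (_ * _); apply/eqP; rewrite eq_le (Py k i)/= leNgt.
    by apply/negP => lt; apply: (noy (y k)).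
  (* A linear form with constant value [b i] vanishes, as seen at [0] and [a i]. *)
  have bi : b i = 0.
    by rewrite -(eqb 0) /dot big1// => j _; rewrite mxE mulr0.
  by move: (a0 i); rewrite (dot_eq0 (etrans (eqb _) bi)) eqxx.
exists (n%:R^-1 *: \sum_k y k) => i.
have n0 : 0 < n%:R :> R by rewrite ltr0n (leq_ltn_trans _ (ltn_ord i)).
rewrite dotZr dot_sumr mulrC ltr_pdivrMr//.
have -> : b i * n%:R = \sum_(k < n) b i by rewrite sumr_const card_ord mulr_natr.
rewrite (bigD1 i)//= [ltRHS](bigD1 i)//= ltr_leD//; first by case: (yP i).
by apply: ler_sum => k _; case: (yP k) => /(_ i).
Qed.

(** * Pulling polynomial descriptions back along a projective map *)

Lemma exists_affine_poly (R : realType) (d : nat) (a : 'rV[R]_d) (c : R) :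
  exists p : mpoly d R, forall x, peval p x = dot a x + c.
Proof.
exists (\sum_(j < d) a 0 j *: mpolyX R (mnm1 j) + mpolyC d c) => x.
rewrite /peval mevalD mevalC (raddf_sum (meval _)); congr (_ + _).
by apply: eq_bigr => j _; rewrite [LHS]mevalZ mevalXU.
Qed.

(** Each monomial of [q] has degree less than [msize q], so [N = msize q] powers of
[s] clear all the denominators. *)
Lemma exists_homogenization (R : realType) (d : nat) (q s : mpoly d R)
    (f : 'I_d -> mpoly d R) :
  exists N (p : mpoly d R), forall v, meval v s != 0 ->
    meval v p = meval v s ^+ N * meval (fun i => meval v (f i) / meval v s) q.
Proof.
exists (msize q), (\sum_(m <- msupp q)
  mcoeff m q *: (s ^+ (msize q - mdeg m) * \prod_i f i ^+ (m i))) => v s0.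
rewrite (raddf_sum (meval v)) [in RHS]mevalE mulr_sumr.
rewrite big_seq [RHS]big_seq; apply: eq_bigr => m /msize_mdeg_lt /ltnW mq.
rewrite [LHS]mevalZ mevalM rmorphXn rmorph_prod /= [RHS]mulrCA; congr (_ * _).
rewrite -[X in _ = _ ^+ X * _](subnK mq) exprD -[RHS]mulrA; congr (_ * _).
rewrite mdegE -prodrXr -big_split/=; apply: eq_bigr => i _.
by rewrite rmorphXn/= -exprMn mulrCA divff// mulr1.
Qed.

(** Where [t <= dot a x + c], the denominator is positive, and clearing it does not
change the signs of the [q i]; the extra polynomial [dot a x + c - t] expresses
that condition. *)
Lemma describes_projective_preimage (R : realType) (d l : nat)
    (q : 'I_l -> mpoly d R) (Q : set 'rV[R]_d) (a y0 : 'rV[R]_d) (c t : R)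
    (M : 'M[R]_d) : 0 < t -> describes q Q ->
  exists p : 'I_l.+1 -> mpoly d R,
    describes p [set x | t <= dot a x + c /\
                         Q ((dot a x + c)^-1 *: (x *m M + y0))].
Proof.
move=> t0 ->; have [s sE] := exists_affine_poly a c.
have [r rE] := exists_affine_poly a (c - t).
have /choice[f fE] j : exists p : mpoly d R, forall x,
    peval p x = (x *m M + y0) 0 j.
  have [p pE] := exists_affine_poly (\row_k M k j) (y0 0 j).
  exists p => x; rewrite pE !mxE; congr (_ + _).
  by apply: eq_bigr => k _; rewrite mxE mulrC.
have /choice[p /choice[N pN]] i : exists (p : mpoly d R) N, forall x,
    dot a x + c != 0 -> peval p x =
    (dot a x + c) ^+ N * peval (q i) ((dot a x + c)^-1 *: (x *m M + y0)).
  have [N [p pE]] := exists_homogenization (q i) s f.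
  exists p, N => x sx; rewrite /peval pE -/(peval _ _) sE//; congr (_ * _).
  by apply: meval_eq => j; rewrite -/(peval _ _) fE [in RHS]mxE mulrC.
exists (fun i => if unlift ord0 i is Some j then p j else r).
have pos x : t <= dot a x + c -> forall i, (0 <= peval (p i) x) =
    (0 <= peval (q i) ((dot a x + c)^-1 *: (x *m M + y0))).
  move=> /(lt_le_trans t0) s0 i.
  by rewrite pN ?gt_eqF// pmulr_rge0 ?exprn_gt0.
have rP x : (0 <= peval r x) = (t <= dot a x + c) by rewrite rE addrA subr_ge0.
apply/seteqP; split=> [x [tx qx] i|x px].
  by case: unliftP => [j _|_]; [rewrite pos | rewrite rP].
have tx : t <= dot a x + c by have := px ord0; rewrite /= unlift_none rP.
by split=> // i; have := px (lift ord0 i); rewrite /= liftK pos.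
Qed.

(** * The polytope attached to a polyhedron *)

(** [B *m pinvmx B] projects along the kernel of [B]; a fixed point [y] of it is
the image of [y *m B] under the linear map [pinvmx B], hence is bounded in terms
of [y *m B]. *)
Lemma kernel_complement_bound (R : realType) (d n : nat) (B : 'M[R]_(d, n))
    (Z : R) : exists2 K, 0 < K & forall y : 'rV[R]_d,
  y *m (B *m pinvmx B) = y -> (forall k, `|(y *m B) 0 k| <= Z) ->
  forall j, `|y 0 j| <= K.
Proof.
exists (1 + \sum_i \sum_j `|Z| * `|pinvmx B i j|).
  by rewrite ltr_pwDl// sumr_ge0// => i _; rewrite sumr_ge0// => j _; rewrite mulr_ge0.
move=> y yM yZ j; rewrite -yM mulmxA mxE (le_trans (ler_norm_sum _ _ _))//.
apply: (@le_trans _ _ (\sum_i `|Z| * `|pinvmx B i j|)).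
  apply: ler_sum => i _; rewrite normrM ler_wpM2r//.
  exact: le_trans (yZ i) (ler_norm Z).
apply: (@le_trans _ _ (\sum_i \sum_k `|Z| * `|pinvmx B i k|)); last by rewrite lerDr.
apply: ler_sum => i _; rewrite (bigD1 j)//= lerDl sumr_ge0//.
Qed.

(** The differences [w - z k] are nonnegative and their sum, multiplied by
[t = 1 / (n + 1)], is [1 - t * w <= 1]; so each of them is at most [n + 1], which
bounds [z k] from below. *)
Lemma projective_bound (R : realType) (n : nat) (z : 'I_n -> R) (w : R) :
  0 <= w -> (forall i, z i <= w) ->
  1 + n.+1%:R^-1 * \sum_k z k = w -> w <= n.+1%:R ->
  forall i, `|z i| <= n.+1%:R.
Proof.
move=> w0 zw wE wn i; set t := n.+1%:R^-1 in wE.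
have t0 : 0 < t by rewrite invr_gt0 ltr0Sn.
have t1 : t * n%:R = 1 - t.
  have : t * n.+1%:R = 1 by rewrite mulVf ?pnatr_eq0.
  by rewrite -natr1 mulrDr mulr1 => /(canRL (addrK _)).
have : t * \sum_k (w - z k) <= 1.
  rewrite sumrB mulrBr sumr_const card_ord -mulr_natl mulrA t1.
  by have := mulr_ge0 (ltW t0) w0; lra.
rewrite (bigD1 i)//= mulrDr => h.
have : t * (w - z i) <= 1.
  apply: le_trans h; rewrite lerDl mulr_ge0 ?(ltW t0)// sumr_ge0// => k _.
  by rewrite subr_ge0.
rewrite -ler_pdivlMl// mulr1 invrK => h'.
rewrite ler_norml (le_trans (zw i) wn) andbT; lra.
Qed.

(** Over the polyhedron the factor [w = 1 / (1 + dot c x)] is at most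
[1 / t = n + 1] and bounds every [a_i.y] from above.  By [projective_bound] the
[a_i.y] are then bounded, and by [kernel_complement_bound] so is [y] itself:
adding the inequalities of a cube makes [Q] bounded without losing any image
point. *)
Lemma projective_polytope (R : realType) (d n : nat) (a : 'I_n -> 'rV[R]_d) :
  exists (Q : set 'rV[R]_d) (c : 'rV[R]_d) (M : 'M[R]_d) (t : R),
  [/\ polytope Q, has_dim Q d, 0 < t & forall x,
    (forall i, dot (a i) x <= 1) <->
    t <= 1 + dot c x /\ Q ((1 + dot c x)^-1 *: (x *m M))].
Proof.
pose t : R := n.+1%:R^-1.
have t0 : 0 < t by rewrite invr_gt0 ltr0Sn.
pose c := - t *: \sum_k a k.
have cE x : dot c x = - (t * \sum_k dot (a k) x).
  by rewrite dotZl dot_suml mulNr.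
pose B := \matrix_(j, k) a k 0 j.
have BE x k : (x *m B) 0 k = dot (a k) x.
  by rewrite mxE; apply: eq_bigr => j _; rewrite mxE mulrC.
pose M := B *m pinvmx B.
have MB : M *m B = B by rewrite mulmxKpV.
have [K K0 KP] := kernel_complement_bound B n.+1%:R.
(* The first [n] inequalities are the images of those of the polyhedron; the
   others say that [y] lies in the cube of half-width [K]. *)
pose f (k : 'I_n + ('I_d + 'I_d)) := match k with
  | inl i => a i + c | inr (inl j) => delta_mx 0 j
  | inr (inr j) => (-1) *: delta_mx 0 j end.
pose b (k : 'I_n + ('I_d + 'I_d)) := if k is inl _ then 1 else K.
have b0 k : 0 < b k by case: k => [?|?]//=.
pose Q := [set y | forall k, dot (f k) y <= b k].
have QP y : Q y <->
    (forall i, dot (a i) y <= 1 - dot c y) /\ (forall j, `|y 0 j| <= K).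
  split=> [Qy|[ay yK] [i|[j|j]]]/=.
  - split=> [i|j]; first by have := Qy (inl i); rewrite /= dotDl lerBrDr.
    rewrite ler_norml; have := Qy (inr (inl j)); have := Qy (inr (inr j)).
    by rewrite /= dotZl dot_delta mulN1r => h1 ->; rewrite lerNl h1.
  - by rewrite dotDl -lerBrDr.
  - by rewrite dot_delta (le_trans (ler_norm _)).
  - by rewrite dotZl dot_delta mulN1r lerNl; have := yK j; rewrite ler_norml => /andP[].
exists Q, c, M, t; split=> //.
- split; first by apply: polyhedron_ineqs => k; exact: ltW.
  by apply: (bounded_box (ltW K0)) => y /QP[].
- exact: has_dim_ineqs.
move=> x; set s := 1 + dot c x; set y := s^-1 *: (x *m M).
have ayE i : dot (a i) y = s^-1 * dot (a i) x.
  by rewrite -!BE -scalemxAl -mulmxA MB mxE.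
have cyE : 0 < s -> 1 - dot c y = s^-1.
  move=> s0; have -> : dot c y = s^-1 * dot c x.
    rewrite !cE mulrN; under eq_bigr do rewrite ayE.
    by rewrite -mulr_sumr mulrCA.
  rewrite (_ : dot c x = s - 1); last by rewrite /s addrC addKr.
  by rewrite mulrBr mulVf ?gt_eqF// mulr1 subKr.
split=> [ax|[ts /QP[ay _]] i]; last first.
  have s0 : 0 < s := lt_le_trans t0 ts.
  by have := ay i; rewrite ayE cyE// -[leRHS]mulr1 ler_pM2l ?invr_gt0.
have ts : t <= s.
  have tn : t * n.+1%:R = 1 by rewrite mulVf ?pnatr_eq0.
  have : t * \sum_k dot (a k) x <= t * n%:R.
    rewrite ler_pM2l// -[n in leRHS]card_ord -sumr_const.
    by apply: ler_sum => k _.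
  by move: tn; rewrite -natr1 mulrDr /s cE; lra.
have s0 : 0 < s := lt_le_trans t0 ts.
have ay i : dot (a i) y <= s^-1.
  by rewrite ayE -[leRHS]mulr1 ler_pM2l ?invr_gt0.
split=> //; apply/QP; rewrite cyE//; split=> //; apply: KP.
  by rewrite -scalemxAl -mulmxA -/M [M *m M]mulmxA MB.
move=> k; rewrite BE; move: k.
apply: (projective_bound _ ay); first by rewrite invr_ge0 ltW.
- by rewrite -(cyE s0) cE opprK.
- by rewrite -[leRHS]invrK lef_pV2// posrE invr_gt0 ltr0Sn.
Qed.

(** * Comparison of the maxima *)

(** Translating by an interior point [x0] and dividing each inequality by its slack
at [x0] brings [P] to the form required by [projective_polytope]. *)
Lemma mP_le_polytope (R : realType) (d : nat) (P : set 'rV[R]_d) :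
  polyhedron P -> has_dim P d ->
  exists Q : set 'rV[R]_d, [/\ polytope Q, has_dim Q d & (mP P <= mP Q + 1)%N].
Proof.
move=> polP dimP; have [n [H [Hhalf PE]]] := polP.
have /choice[a /choice[b ab]] := Hhalf.
have PE' : P = [set x | forall i, dot (a i) x <= b i].
  rewrite PE; apply/seteqP; split=> x Px i.
    by have := Px i Logic.I; rewrite (ab i).2.
  by move=> _; rewrite (ab i).2; exact: Px.
have [|x0 x0P] := @interior_point _ _ _ a b (fun i => (ab i).1); first by rewrite -PE'.
have [Q [c [M [t [polQ dimQ t0 QP]]]]] :=
  projective_polytope (fun i => (b i - dot (a i) x0)^-1 *: a i).
exists Q; split=> //; have [[q qQ] _] := mP_spec polQ.1.
have [p pP] :=
  describes_projective_preimage c (- (x0 *m M)) (1 - dot c x0) M t0 qQ.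
rewrite addn1; apply: ((mP_spec polP).2 _ p).
rewrite /describes -pP PE'; apply/seteqP.
have sE x : dot c x + (1 - dot c x0) = 1 + dot c (x - x0) by rewrite dotBr addrCA.
have PQ x : (forall i, dot (a i) x <= b i) <-> t <= dot c x + (1 - dot c x0) /\
    Q ((dot c x + (1 - dot c x0))^-1 *: (x *m M - x0 *m M)).
  rewrite sE -mulmxBl -QP; split=> h i; move: (h i);
    by rewrite dotZl dotBr ler_pdivrMl ?subr_gt0// mulr1 lerD2r.
by split=> x /PQ.
Qed.

Lemma nat_max_unbounded (A : set nat) :
  ~ (exists b, forall k, A k -> (k <= b)%N) -> nat_max A = 0%N.
Proof.
move=> nb; rewrite /nat_max; case: xgetP => // m _ [_ ubm].
by case: nb; exists m => k Ak; rewrite -leEnat; exact: ubm.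
Qed.

(** If [C] is unbounded then so is [A], and both maxima are [0]. *)
Lemma nat_max_dominated (A C : set nat) :
  (forall k, A k -> C k) ->
  (forall k, C k -> exists2 j, A j & (k <= j + 1)%N) ->
  (nat_max A <= nat_max C)%N /\ (nat_max C <= nat_max A + 1)%N.
Proof.
move=> AC CA; have [[b Cb]|nbC] := pselect (exists b, forall k, C k -> (k <= b)%N).
  have [[k Ck]|/nonemptyPn C0] := pselect (C !=set0); last first.
    suff -> : A = C by rewrite leq_addr.
    by apply/seteqP; split=> // k; rewrite C0.
  have [j Aj _] := CA k Ck.
  have [CmC maxC] := nat_max_spec (ex_intro _ k Ck) Cb.
  have [AmA maxA] := nat_max_spec (ex_intro _ j Aj) (fun i Ai => Cb i (AC i Ai)).
  split; first exact/maxC/AC.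
  by have [i Ai le] := CA _ CmC; rewrite (leq_trans le)// leq_add2r maxA.
rewrite (nat_max_unbounded nbC) nat_max_unbounded// => -[b Ab]; apply: nbC.
by exists (b + 1)%N => k /CA[j Aj le]; rewrite (leq_trans le)// leq_add2r Ab.
Qed.

Theorem proposition2p5 (R : realType) (d : nat) (hd : (2 <= d)%N) :
  (mP_polytopes R d <= mP_polyhedra R d)%N /\
  (mP_polyhedra R d <= mP_polytopes R d + 1)%N.
Proof.
have sub k : [set mP P | P in [set P : set 'rV[R]_d | polytope P /\ has_dim P d]] k ->
    [set mP P | P in [set P : set 'rV[R]_d | polyhedron P /\ has_dim P d]] k.
  by move=> [P [[polP _] dimP] <-]; exists P.
have dom k : [set mP P | P in [set P : set 'rV[R]_d | polyhedron P /\ has_dim P d]] k ->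
    exists2 j, [set mP P | P in [set P : set 'rV[R]_d | polytope P /\ has_dim P d]] j
      & (k <= j + 1)%N.
  move=> [P [polP dimP] <-]; have [Q [polQ dimQ le]] := mP_le_polytope polP dimP.
  by exists (mP Q) => //; exists Q.
exact: nat_max_dominated.
Qed.
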